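(* Let $n\in\mathbb{N}$ and let $T$ be a set of arithmetical sentences (possibly empty). The set of formulas provable in $\mathsf{S}^{\Pi}_n$ from assumptions $T$ is closed under the induction rule $(\mathrm{IR})$ for $\Pi_{n+1}$-formulas: if $\varphi(x)$ is a $\Pi_{n+1}$-formula and both $\varphi(0)$ and $\forall x\,(\varphi(x)\to\varphi(s(x)))$ are provable in $\mathsf{S}^{\Pi}_n$ from $T$, then so is $\forall x\,\varphi(x)$.
   Context: **Formulas and sequents.** Arithmetical terms are built from individual variables $\mathit{Var}=\{x_0,x_1,\dots\}$ and the constant $0$ by the unary symbol $s$ and the binary symbols $+,\cdot$. Arithmetical formulas are given by $\varphi::=t=t\mid t\neq t\mid(\varphi\wedge\varphi)\mid(\varphi\vee\varphi)\mid\forall y\,\varphi\mid\exists y\,\varphi$. Negation $\overline{\varphi}$ is the syntactic operation swapping $=$ with $\neq$, $\wedge$ with $\vee$, $\forall$ with $\exists$ (so $\overline{\overline\varphi}=\varphi$). Put $\bot:=0\neq 0$, $\varphi\to\psi:=\overline\varphi\vee\psi$. $x\leq y$ abbreviates $\exists z\,(z+x=y)$. $\varphi[y\mapsto t]$ is the substitution of $t$ for all free occurrences of $y$ (no variable of $t$ may become bound); $\varphi(t)$ stands for $\varphi[x\mapsto t]$ when $x$ is clear. A sequent is a finite multiset of formulas, interpreted as $\bigvee\Gamma$ (with $\bigvee\emptyset:=\bot$); the comma denotes multiset union. A formula $\varphi$ is called provable if the sequent $\{\varphi\}$ is. $\mathit{FV}$ denotes the set of free variables. **Classes.** Bounded quantifiers: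 $\forall y\leq t\,\varphi:=\forall y(y\leq t\to\varphi)$, $\exists y\leq t\,\varphi:=\exists y(y\leq t\wedge\varphi)$, with $y$ not in $t$. $\Delta_0=\Sigma_0=\Pi_0$ is the set of formulas built from atomic formulas by logical connectives and bounded quantifiers only. A formula is $\Sigma_{n+1}$ (resp. $\Pi_{n+1}$) if it is obtained from $\Pi_n$ (resp. $\Sigma_n$) formulas using existential (resp. universal) quantifiers and $\wedge,\vee$. **Calculus $\mathsf{SQ}$.** Initial sequents: $\Gamma,t_0=t_1,t_0\neq t_1$ and $\Gamma,s(t)\neq0$. Rules (premisses / conclusion): $(\wedge)$: $\Gamma,\varphi$ and $\Gamma,\psi$ / $\Gamma,\varphi\wedge\psi$; $(\vee)$: $\Gamma,\varphi,\psi$ / $\Gamma,\varphi\vee\psi$; $(\forall)$: $\Gamma,\varphi[y\mapsto z]$ / $\Gamma,\forall y\,\varphi$, where $z\notin\mathit{FV}(\Gamma,\forall y\,\varphi)$ ($z$ is the active variable); $(\exists)$: $\Gamma,\varphi[y\mapsto t],\exists y\,\varphi$ / $\Gamma,\exists y\,\varphi$; $(\mathsf{ref})$: $\Gamma,t\neq t$ / $\Gamma$; $(\mathsf{rep})$: $\Gamma,t_0\neq t_1,(u_0\neq u_1)[y\mapsto t_0],(u_0\neq u_1)[y\mapsto t_1]$ / $\Gamma,t_0\neq t_1,(u_0\neq u_1)[y\mapsto t_0]$; $(\mathsf{add}_0)$: $\Gamma,t+0\neq t$ / $\Gamma$; $(\mathsf{add}_s)$: $\Gamma,t+s(u)\neq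 s(t+u)$ / $\Gamma$; $(\mathsf{mult}_0)$: $\Gamma,t\cdot0\neq0$ / $\Gamma$; $(\mathsf{mult}_s)$: $\Gamma,t\cdot s(u)\neq t\cdot u+t$ / $\Gamma$; $(\mathsf{pred})$: $\Gamma,s(t_0)\neq s(t_1),t_0\neq t_1$ / $\Gamma,s(t_0)\neq s(t_1)$; $(\mathsf{case})$: left premiss $\Gamma[y\mapsto0]$ and right premiss $\Gamma[y\mapsto s(y)]$ / $\Gamma$, where $y\in\mathit{FV}(\Gamma)$ ($y$ is the active variable); $(\mathsf{weak})$: $\Gamma$ / $\Gamma,\Delta$; $(\mathsf{cut})$: left premiss $\Gamma,\varphi$ and right premiss $\Gamma,\overline\varphi$ / $\Gamma$. **Proofs of $\mathsf{S}^{\Pi}_n$ from assumptions.** An $\infty$-proof from assumptions $T$ is a possibly infinite tree whose nodes are marked by sequents, constructed according to the rules of $\mathsf{SQ}$, with every leaf marked by an initial sequent of $\mathsf{SQ}$ or by a sequent $\{\varphi\}$ with $\varphi\in T$, such that every infinite branch has a tail satisfying conditions (a)–(c) below. It is an $\infty$-proof of $\mathsf{S}^{\Pi}_n$ from $T$ if every infinite branch has a tail satisfying all of the following: (a) the tail does not pass through left premisses of $(\mathsf{case})$; (b) if the tail passes through the right premiss $\Gamma[z\mapsto s(z)]$ of $(\mathsf{case})$, then after that application the tail does not intersect applications of $(\forall)$ with active variable $z$; (c) for some variable $y$, the tail passes through the right premiss of $(\mathsf{case})$ with active variable $y$ infinitely many times; (d) if the tail passes through the left (right) premiss of $(\wedge)$,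 then $\varphi$ ($\psi$) is in $\Pi_{n+1}$; (e) if the tail intersects an application of $(\forall)$, then $\varphi[y\mapsto z]\in\Pi_{n+1}$; (f) if the tail passes through the left (right) premiss of $(\mathsf{cut})$, then $\varphi$ ($\overline\varphi$) is in $\Pi_{n+1}$; (g* ) if the tail passes through the right premiss $\Gamma[z\mapsto s(z)]$ of $(\mathsf{case})$, then $\Gamma$ consists entirely of $\Pi_{n+1}$-formulas. Such a tree is regular if it contains only finitely many non-isomorphic subtrees with respect to the marking of sequents. A sequent $\Gamma$ is provable in $\mathsf{S}^{\Pi}_n$ from assumptions $T$ if there is a regular $\infty$-proof of $\mathsf{S}^{\Pi}_n$ from $T$ with root marked by $\Gamma$. *)

(* Defs.v *)
From HB Require Import structures.
From mathcomp Require Import all_boot.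
From mathcomp Require Import finmap multiset.
Set Implicit Arguments.
Unset Strict Implicit.
Unset Printing Implicit Defensive.
Local Open Scope mset_scope.

(** * Syntax *)

Definition var := nat.

Inductive term : Type :=
| Var of var
| Zero
| Succ of term
| Add of term & term
| Mul of term & term.

Inductive formula : Type :=
| Eq of term & term
| Neq of term & term
| And of formula & formula
| Or of formula & formula
| All of var & formula
| Ex of var & formula.

(** Countable (hence choice and equality) structures, required by [{mset _}]. *)

Fixpoint term_encode (t : term) : GenTree.tree nat :=
  match t with
  | Var x => GenTree.Leaf x
  | Zero => GenTree.Node 0 [::]
  | Succ t => GenTree.Node 1 [:: term_encode t]
  | Add t u => GenTree.Node 2 [:: term_encode t; term_encode u]
  | Mul t u => GenTree.Node 3 [:: term_encode t; term_encode u]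
  end.

Fixpoint term_decode (e : GenTree.tree nat) : option term :=
  match e with
  | GenTree.Leaf x => Some (Var x)
  | GenTree.Node 0 [::] => Some Zero
  | GenTree.Node 1 [:: e1] => omap Succ (term_decode e1)
  | GenTree.Node 2 [:: e1; e2] =>
      obind (fun t => omap (Add t) (term_decode e2)) (term_decode e1)
  | GenTree.Node 3 [:: e1; e2] =>
      obind (fun t => omap (Mul t) (term_decode e2)) (term_decode e1)
  | _ => None
  end.

Lemma term_encodeK : pcancel term_encode term_decode.
Proof. by elim=> //= [t -> | t -> u -> | t -> u ->]. Qed.

HB.instance Definition _ := Countable.copy term (pcan_type term_encodeK).

Fixpoint formula_encode (f : formula) : GenTree.tree (term + var) :=
  match f with
  | Eq t u => GenTree.Node 0 [:: GenTree.Leaf (inl t); GenTree.Leaf (inl u)]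
  | Neq t u => GenTree.Node 1 [:: GenTree.Leaf (inl t); GenTree.Leaf (inl u)]
  | And f g => GenTree.Node 2 [:: formula_encode f; formula_encode g]
  | Or f g => GenTree.Node 3 [:: formula_encode f; formula_encode g]
  | All y f => GenTree.Node 4 [:: GenTree.Leaf (inr y); formula_encode f]
  | Ex y f => GenTree.Node 5 [:: GenTree.Leaf (inr y); formula_encode f]
  end.

Fixpoint formula_decode (e : GenTree.tree (term + var)) : option formula :=
  match e with
  | GenTree.Node 0 [:: GenTree.Leaf (inl t); GenTree.Leaf (inl u)] =>
      Some (Eq t u)
  | GenTree.Node 1 [:: GenTree.Leaf (inl t); GenTree.Leaf (inl u)] =>
      Some (Neq t u)
  | GenTree.Node 2 [:: e1; e2] =>
      obind (fun f => omap (And f) (formula_decode e2)) (formula_decode e1)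
  | GenTree.Node 3 [:: e1; e2] =>
      obind (fun f => omap (Or f) (formula_decode e2)) (formula_decode e1)
  | GenTree.Node 4 [:: GenTree.Leaf (inr y); e2] =>
      omap (All y) (formula_decode e2)
  | GenTree.Node 5 [:: GenTree.Leaf (inr y); e2] =>
      omap (Ex y) (formula_decode e2)
  | _ => None
  end.

Lemma formula_encodeK : pcancel formula_encode formula_decode.
Proof. by elim=> //= [f -> g -> | f -> g -> | y f -> | y f ->]. Qed.

HB.instance Definition _ := Countable.copy formula (pcan_type formula_encodeK).

Fixpoint neg (f : formula) : formula :=
  match f with
  | Eq t u => Neq t u
  | Neq t u => Eq t u
  | And f g => Or (neg f) (neg g)
  | Or f g => And (neg f) (neg g)
  | All y f => Ex y (neg f)
  | Ex y f => All y (neg f)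
  end.

Definition Imp (f g : formula) : formula := Or (neg f) g.

Fixpoint tvars (t : term) : seq var :=
  match t with
  | Var x => [:: x]
  | Zero => [::]
  | Succ t => tvars t
  | Add t u | Mul t u => tvars t ++ tvars u
  end.

Fixpoint fv (f : formula) : seq var :=
  match f with
  | Eq t u | Neq t u => tvars t ++ tvars u
  | And f g | Or f g => fv f ++ fv g
  | All y f | Ex y f => [seq x <- fv f | x != y]
  end.

Definition sentence (f : formula) : Prop := fv f = [::].

Fixpoint tsubst (y : var) (t u : term) : term :=
  match u with
  | Var x => if x == y then t else Var x
  | Zero => Zero
  | Succ u => Succ (tsubst y t u)
  | Add u v => Add (tsubst y t u) (tsubst y t v)
  | Mul u v => Mul (tsubst y t u) (tsubst y t v)
  end.

(** Literal replacement of the free occurrences of [y] by [t].  It does not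
    rename bound variables: absence of capture is the separate condition
    [substitutable], imposed wherever capture would be possible. *)
Fixpoint subst (y : var) (t : term) (f : formula) : formula :=
  match f with
  | Eq u v => Eq (tsubst y t u) (tsubst y t v)
  | Neq u v => Neq (tsubst y t u) (tsubst y t v)
  | And f g => And (subst y t f) (subst y t g)
  | Or f g => Or (subst y t f) (subst y t g)
  | All x f => if x == y then All x f else All x (subst y t f)
  | Ex x f => if x == y then Ex x f else Ex x (subst y t f)
  end.

Fixpoint substitutable (y : var) (t : term) (f : formula) : bool :=
  match f with
  | Eq _ _ | Neq _ _ => true
  | And f g | Or f g => substitutable y t f && substitutable y t g
  | All x g | Ex x g =>
      (y \notin fv f) || ((x \notin tvars t) && substitutable y t g)
  end.

(** * Arithmetical hierarchy *)

(** [t <= u], with [z] as the bound variable of the abbreviation. *)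
Definition Le (z : var) (t u : term) : formula := Ex z (Eq (Add (Var z) t) u).

(** Any [z] distinct from [y] and not in [t] may serve as the bound variable of
    the abbreviation [y <= t]. *)
Inductive Delta0 : formula -> Prop :=
| Delta0_eq t u : Delta0 (Eq t u)
| Delta0_neq t u : Delta0 (Neq t u)
| Delta0_and f g : Delta0 f -> Delta0 g -> Delta0 (And f g)
| Delta0_or f g : Delta0 f -> Delta0 g -> Delta0 (Or f g)
| Delta0_all y z t f :
    y \notin tvars t -> z \notin tvars t -> z <> y -> Delta0 f ->
    Delta0 (All y (Imp (Le z (Var y) t) f))
| Delta0_ex y z t f :
    y \notin tvars t -> z \notin tvars t -> z <> y -> Delta0 f ->
    Delta0 (Ex y (And (Le z (Var y) t) f)).

Inductive ex_closure (P : formula -> Prop) : formula -> Prop :=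
| ex_closure_base f : P f -> ex_closure P f
| ex_closure_and f g :
    ex_closure P f -> ex_closure P g -> ex_closure P (And f g)
| ex_closure_or f g :
    ex_closure P f -> ex_closure P g -> ex_closure P (Or f g)
| ex_closure_ex y f : ex_closure P f -> ex_closure P (Ex y f).

Inductive all_closure (P : formula -> Prop) : formula -> Prop :=
| all_closure_base f : P f -> all_closure P f
| all_closure_and f g :
    all_closure P f -> all_closure P g -> all_closure P (And f g)
| all_closure_or f g :
    all_closure P f -> all_closure P g -> all_closure P (Or f g)
| all_closure_all y f : all_closure P f -> all_closure P (All y f).

Fixpoint Sigma (n : nat) : formula -> Prop :=
  if n is m.+1 then ex_closure (Pi m) else Delta0
with Pi (n : nat) : formula -> Prop :=
  if n is m.+1 then all_closure (Sigma m) else Delta0.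

(** * Sequents and inferences *)

Notation sequent := {mset formula}.

Definition fv_sequent (G : sequent) : seq var := flatten [seq fv f | f <- G].

Definition subst_sequent (y : var) (t : term) (G : sequent) : sequent :=
  seq_mset [seq subst y t f | f <- G].

(** Instances of the rules of SQ; leaves (initial sequents and assumptions) are
    inferences without premisses. *)
Inductive inference : Type :=
| IAssumption of formula
| IId of sequent & term & term
| ISucc of sequent & term
| IAnd of sequent & formula & formula
| IOr of sequent & formula & formula
| IAll of sequent & var & formula & var (* the last argument is active *)
| IEx of sequent & var & formula & term
| IRef of sequent & term
| IRep of sequent & term & term & var & term & term (* G t0 t1 y u0 u1 *)
| IAdd0 of sequent & term
| IAddS of sequent & term & term
| IMul0 of sequent & term
| IMulS of sequent & term & term
| IPred of sequent & term & term
| ICase of sequent & var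
| IWeak of sequent & sequent
| ICut of sequent & formula.

Definition conclusion (r : inference) : sequent :=
  match r with
  | IAssumption f => [mset f]
  | IId G t0 t1 => Eq t0 t1 +` (Neq t0 t1 +` G)
  | ISucc G t => Neq (Succ t) Zero +` G
  | IAnd G f g => And f g +` G
  | IOr G f g => Or f g +` G
  | IAll G y f _ => All y f +` G
  | IEx G y f _ => Ex y f +` G
  | IRep G t0 t1 y u0 u1 => Neq t0 t1 +` (subst y t0 (Neq u0 u1) +` G)
  | IPred G t0 t1 => Neq (Succ t0) (Succ t1) +` G
  | IWeak G D => G `+` D
  | IRef G _ | IAdd0 G _ | IAddS G _ _ | IMul0 G _ | IMulS G _ _
  | ICase G _ | ICut G _ => G
  end.

(** Premisses from left to right. *)
Definition premisses (r : inference) : seq sequent :=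
  match r with
  | IAssumption _ | IId _ _ _ | ISucc _ _ => [::]
  | IAnd G f g => [:: f +` G; g +` G]
  | IOr G f g => [:: f +` (g +` G)]
  | IAll G y f z => [:: subst y (Var z) f +` G]
  | IEx G y f t => [:: subst y t f +` (Ex y f +` G)]
  | IRef G t => [:: Neq t t +` G]
  | IRep G t0 t1 y u0 u1 =>
      [:: Neq t0 t1 +`
          (subst y t0 (Neq u0 u1) +` (subst y t1 (Neq u0 u1) +` G))]
  | IAdd0 G t => [:: Neq (Add t Zero) t +` G]
  | IAddS G t u => [:: Neq (Add t (Succ u)) (Succ (Add t u)) +` G]
  | IMul0 G t => [:: Neq (Mul t Zero) Zero +` G]
  | IMulS G t u => [:: Neq (Mul t (Succ u)) (Add (Mul t u) t) +` G]
  | IPred G t0 t1 => [:: Neq (Succ t0) (Succ t1) +` (Neq t0 t1 +` G)]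
  | ICase G y =>
      [:: subst_sequent y Zero G; subst_sequent y (Succ (Var y)) G]
  | IWeak G _ => [:: G]
  | ICut G f => [:: f +` G; neg f +` G]
  end.

(** No capture condition is needed in [ICase]: a free occurrence of [y] is never
    in the scope of a quantifier over [y], the only variable of [s(y)]. *)
Definition side_condition (T : formula -> Prop) (r : inference) : Prop :=
  match r with
  | IAssumption f => T f
  | IAll G y f z =>
      (z \notin fv_sequent (All y f +` G)) /\ substitutable y (Var z) f
  | IEx G y f t => substitutable y t f
  | ICase G y => y \in fv_sequent G
  | _ => True
  end.

(** * Infinite proofs *)

(** Nodes are addressed by the list of premiss choices leading from the root to
    them ([true] for a right premiss, [false] for a left or single one);
    [p a = None] means that [a] is not a node.  A node carries the inference
    whose conclusion is the sequent marking it. *)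
Definition ptree := seq bool -> option inference.

Definition marking (p : ptree) (a : seq bool) : option sequent :=
  omap conclusion (p a).

Definition locally_correct (T : formula -> Prop) (p : ptree) : Prop :=
  forall a : seq bool,
    match p a with
    | Some r =>
        side_condition T r /\
        (forall i : bool, marking p (rcons a i) = onth (premisses r) i)
    | None => forall i : bool, p (rcons a i) = None
    end.

(** The [k]-th node of the branch with choices [b] is [mkseq b k], and the branch
    continues from it through its premiss [b k]. *)
Definition infinite_branch (p : ptree) (b : nat -> bool) : Prop :=
  forall k, p (mkseq b k) <> None.

(** Conditions on the tail of [b] starting at its [N]-th node. *)

Definition cond_a (p : ptree) (b : nat -> bool) (N : nat) : Prop :=
  forall k G z, N <= k -> p (mkseq b k) = Some (ICase G z) -> b k = true.

Definition cond_b (p : ptree) (b : nat -> bool) (N : nat) : Prop :=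
  forall k G z, N <= k -> p (mkseq b k) = Some (ICase G z) -> b k = true ->
  forall m D y f, k < m -> p (mkseq b m) <> Some (IAll D y f z).

Definition cond_c (p : ptree) (b : nat -> bool) (N : nat) : Prop :=
  exists y, forall m, exists k G,
    [/\ N <= k, m <= k, p (mkseq b k) = Some (ICase G y) & b k = true].

Definition cond_d (n : nat) (p : ptree) (b : nat -> bool) (N : nat) : Prop :=
  forall k G f g, N <= k -> p (mkseq b k) = Some (IAnd G f g) ->
  Pi n.+1 (if b k then g else f).

Definition cond_e (n : nat) (p : ptree) (b : nat -> bool) (N : nat) : Prop :=
  forall k G y f z, N <= k -> p (mkseq b k) = Some (IAll G y f z) ->
  Pi n.+1 (subst y (Var z) f).

Definition cond_f (n : nat) (p : ptree) (b : nat -> bool) (N : nat) : Prop :=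
  forall k G f, N <= k -> p (mkseq b k) = Some (ICut G f) ->
  Pi n.+1 (if b k then neg f else f).

Definition cond_g (n : nat) (p : ptree) (b : nat -> bool) (N : nat) : Prop :=
  forall k G z, N <= k -> p (mkseq b k) = Some (ICase G z) -> b k = true ->
  forall f, f \in G -> Pi n.+1 f.

Definition infty_proof (T : formula -> Prop) (p : ptree) : Prop :=
  locally_correct T p /\
  forall b, infinite_branch p b ->
  exists N, [/\ cond_a p b N, cond_b p b N & cond_c p b N].

Definition SPi_infty_proof (n : nat) (T : formula -> Prop) (p : ptree) : Prop :=
  infty_proof T p /\
  forall b, infinite_branch p b ->
  exists N, [/\ cond_a p b N, cond_b p b N & cond_c p b N] /\
            [/\ cond_d n p b N, cond_e n p b N, cond_f n p b N
              & cond_g n p b N].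

(** Every subtree is isomorphic to one of finitely many subtrees.  Only the
    marking by sequents is compared, not the choice of inferences. *)
Definition regular (p : ptree) : Prop :=
  exists s : seq (seq bool), forall a, p a <> None ->
  exists2 a', a' \in s & forall c, marking p (a ++ c) = marking p (a' ++ c).

Definition SPi_provable_sequent (n : nat) (T : formula -> Prop) (G : sequent)
    : Prop :=
  exists p : ptree,
    [/\ SPi_infty_proof n T p, regular p & marking p [::] = Some G].

Definition SPi_provable (n : nat) (T : formula -> Prop) (f : formula) : Prop :=
  SPi_provable_sequent n T [mset f].

(* Main.v *)
(** The [forall] rule with active variable [x] reduces the goal to [phi], which
    is derived from itself: [case] on [x] leaves [phi(0)], which is given, and
    [phi(s(x))], which a cut on [phi] reduces to [phi, phi(s(x))], a weakening of
    [phi], and to [neg phi, phi(s(x))], which follows from the induction step.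
    The only new infinite branch runs through [case] right, [cut] left and
    [weak] forever; on it the cut formula and the sequents at [case] are the
    [Pi_(n+1)]-formula [phi]. *)

From Stdlib Require Import Classical.
From mathcomp Require Import all_boot.
From mathcomp Require Import finmap multiset.
Require Import Defs.
Set Implicit Arguments.
Unset Strict Implicit.
Unset Printing Implicit Defensive.
Local Open Scope mset_scope.

(** * Negation, substitution and fresh variables *)

Lemma negK : involutive neg.
Proof. by elim=> //= [f -> g -> | f -> g -> | y f -> | y f ->]. Qed.

Lemma subst_neg y t f : subst y t (neg f) = neg (subst y t f).
Proof.
by elim: f => //= [f -> g -> | f -> g -> | z f IH | z f IH] //;
  case: ifP => //= _; rewrite IH.
Qed.

Lemma tsubst_id y u : tsubst y (Var y) u = u.
Proof.
by elim: u => //= [x | u -> | u -> v -> | u -> v ->] //; case: eqP => // ->.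
Qed.

Lemma subst_id y f : subst y (Var y) f = f.
Proof.
by elim: f => //= [t u | t u | f -> g -> | f -> g -> | x f -> | x f ->];
  rewrite ?tsubst_id ?if_same.
Qed.

Lemma substitutable_id y f : substitutable y (Var y) f.
Proof.
by elim: f => //= [f -> g -> | f -> g -> | x f -> | x f ->] //;
  rewrite mem_filter inE andbT; case: (eqVneq x y) => //= _; rewrite orbT.
Qed.

Lemma tsubst_notin y t u : y \notin tvars u -> tsubst y t u = u.
Proof.
elim: u => //= [x | u IH /IH -> | u IHu v IHv | u IHu v IHv] //.
- by rewrite inE eq_sym => /negPf ->.
- by rewrite mem_cat negb_or => /andP[/IHu -> /IHv ->].
- by rewrite mem_cat negb_or => /andP[/IHu -> /IHv ->].
Qed.

Lemma subst_notin y t f : y \notin fv f -> subst y t f = f.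
Proof.
elim: f => //= [u v | u v | f IHf g IHg | f IHf g IHg | x f IH | x f IH].
- by rewrite mem_cat negb_or => /andP[? ?]; rewrite !tsubst_notin.
- by rewrite mem_cat negb_or => /andP[? ?]; rewrite !tsubst_notin.
- by rewrite mem_cat negb_or => /andP[/IHf -> /IHg ->].
- by rewrite mem_cat negb_or => /andP[/IHf -> /IHg ->].
- by rewrite mem_filter eq_sym; case: eqP => //= _ /IH ->.
- by rewrite mem_filter eq_sym; case: eqP => //= _ /IH ->.
Qed.

(** Only finitely many variables are quantified in [f], and a variable beyond all of them cannot be
    captured. *)
Lemma substitutable_large y f :
  exists m, forall z, m <= z -> substitutable y (Var z) f.
Proof.
elim: f => [t u | t u | f [m Hm] g [k Hk] | f [m Hm] g [k Hk]
           | x f [m Hm] | x f [m Hm]] /=; try by exists 0.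
- by exists (maxn m k) => z; rewrite geq_max => /andP[/Hm -> /Hk ->].
- by exists (maxn m k) => z; rewrite geq_max => /andP[/Hm -> /Hk ->].
- exists (maxn m x.+1) => z; rewrite geq_max => /andP[/Hm -> xz].
  by rewrite inE neq_ltn xz andbT orbT.
- exists (maxn m x.+1) => z; rewrite geq_max => /andP[/Hm -> xz].
  by rewrite inE neq_ltn xz andbT orbT.
Qed.

Lemma fresh_var y f (s : seq var) :
  exists2 z, z \notin s & substitutable y (Var z) f.
Proof.
have [m Hm] := substitutable_large y f.
(* At least [m], hence safe from capture, and larger than every member of [s]. *)
exists (maxn m (\max_(i <- s) i).+1); last by rewrite Hm ?leq_maxl.
apply/negP => zs; have := @leq_bigmax_seq _ s xpredT id _ zs isT.
by rewrite leqNgt leq_max ltnS leqnn orbT.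
Qed.

(** Induction measure for [provable_id], whose quantifier case passes to a substitution instance
    rather than a subformula. *)
Fixpoint formula_size (f : formula) : nat :=
  match f with
  | Eq _ _ | Neq _ _ => 0
  | And f g | Or f g => (formula_size f + formula_size g).+1
  | All _ f | Ex _ f => (formula_size f).+1
  end.

Lemma formula_size_neg f : formula_size (neg f) = formula_size f.
Proof. by elim: f => //= [f -> g -> | f -> g -> | y f -> | y f ->]. Qed.

Lemma formula_size_subst y t f : formula_size (subst y t f) = formula_size f.
Proof.
by elim: f => //= [f -> g -> | f -> g -> | x f IH | x f IH] //;
  case: ifP => //= _; rewrite IH.
Qed.

Lemma subst_sequent1 y t f : subst_sequent y t [mset f] = [mset subst y t f].
Proof.
rewrite /subst_sequent enum_msetn /= mset_cons -[RHS]msetD0; congr (_ `+` _).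
by apply/eqP/mset_eqP=> g; rewrite mset_seqE mset0E.
Qed.

Lemma fv_sequent1 f : fv_sequent [mset f] = fv f.
Proof. by rewrite /fv_sequent enum_msetn /= cats0. Qed.

(** * Branches and trees *)

Lemma mkseq_add (b : nat -> bool) m k :
  mkseq b (m + k) = mkseq b m ++ mkseq (fun i => b (m + i)) k.
Proof. by rewrite /mkseq iotaD map_cat add0n -[X in iota X k]addn0 iotaDl -map_comp. Qed.

Definition accepted n (p : ptree) (b : nat -> bool) : Prop :=
  exists N, [/\ cond_a p b N, cond_b p b N & cond_c p b N] /\
            [/\ cond_d n p b N, cond_e n p b N, cond_f n p b N
              & cond_g n p b N].

Section Shift.
Variables (n : nat) (p q : ptree) (b : nat -> bool) (m : nat).
Hypothesis subtree : forall c, p (mkseq b m ++ c) = q c.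

Let b' k := b (m + k).

Let at_shift k : p (mkseq b (m + k)) = q (mkseq b' k).
Proof. by rewrite mkseq_add subtree. Qed.

Lemma infinite_branch_shift : infinite_branch p b -> infinite_branch q b'.
Proof. by move=> pb k; rewrite -at_shift. Qed.

(** All conditions concern tails only: the tail of [b'] from [N] on is the tail of [b] from [m + N]
    on. *)
Lemma accepted_shift : accepted n q b' -> accepted n p b.
Proof.
have split k N : m + N <= k -> exists2 j, k = m + j & N <= j.
  move=> mNk; have mk := leq_trans (leq_addr N m) mNk.
  by exists (k - m); rewrite ?subnKC // leq_subRL.
move=> [N [[Ha Hb [y Hc]] [Hd He Hf Hg]]]; exists (m + N); split; split.
- by move=> k G z /split[j -> Nj]; rewrite at_shift; apply: Ha.
- move=> k G z /split[j -> Nj]; rewrite at_shift => pj bj l D w f jl.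
  have /split[i Ei ji] : m + j.+1 <= l by rewrite addnS.
  by rewrite Ei at_shift; apply: Hb pj bj _ _ _ _ ji.
- exists y => l; have [k [G [Nk lk qk bk]]] := Hc l.
  exists (m + k), G; rewrite leq_add2l at_shift; split=> //.
  exact: leq_trans lk (leq_addl _ _).
- by move=> k G f g /split[j -> Nj]; rewrite at_shift; apply: Hd.
- by move=> k G w f z /split[j -> Nj]; rewrite at_shift; apply: He.
- by move=> k G f /split[j -> Nj]; rewrite at_shift; apply: Hf.
- by move=> k G z /split[j -> Nj]; rewrite at_shift; apply: Hg.
Qed.

End Shift.

(** The tree without nodes is included: it stands for a missing premiss. *)
Definition proof_tree n T (p : ptree) : Prop :=
  [/\ locally_correct T p,
      forall b, infinite_branch p b -> accepted n p b & regular p].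

Lemma SPi_provable_sequentP n T G :
  SPi_provable_sequent n T G <->
  exists2 p, proof_tree n T p & marking p [::] = Some G.
Proof.
split=> [[p [[[Lp _] Bp] Rp Mp]] | [p [Lp Bp Rp] Mp]]; first by exists p.
exists p; split=> //; split=> //; split=> // b /Bp[N [Habc _]].
by exists N.
Qed.

Lemma proof_tree_empty n T : proof_tree n T (fun=> None).
Proof. by split=> [a | b /(_ 0) | ] //; exists [::]. Qed.

(** Allows [provable_rule] to treat rules with fewer than two premisses as binary ones. *)
Lemma premiss_proof_tree n T o :
  (forall G, o = Some G -> SPi_provable_sequent n T G) ->
  exists2 p, proof_tree n T p & marking p [::] = o.
Proof.
case: o => [G /(_ G erefl)/SPi_provable_sequentP // | _].
by exists (fun=> None) => //; apply: proof_tree_empty.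
Qed.

Definition node r (q : bool -> ptree) : ptree :=
  fun a => if a is i :: a' then q i a' else Some r.

(** After its first step an infinite branch of the new tree runs inside the proof of one premiss, so
    finitely many rule applications never endanger the branch conditions. *)
Lemma provable_rule n T r :
  side_condition T r ->
  (forall i G, onth (premisses r) (nat_of_bool i) = Some G ->
     SPi_provable_sequent n T G) ->
  SPi_provable_sequent n T (conclusion r).
Proof.
move=> side prem.
have [q0 [L0 B0 [s0 R0]] M0] := premiss_proof_tree (prem false).
have [q1 [L1 B1 [s1 R1]] M1] := premiss_proof_tree (prem true).
pose q (i : bool) := if i then q1 else q0.
apply/SPi_provable_sequentP; exists (node r q) => //; split.
- case=> [|i a] /=; first by split=> // -[].
  by case: i; [apply: L1 | apply: L0].
- move=> b pb; have sub c : node r q (mkseq b 1 ++ c) = q (b 0) c by [].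
  have qb := infinite_branch_shift sub pb.
  by apply: (accepted_shift sub); case: (b 0) qb; [apply: B1 | apply: B0].
- exists ([::] :: map (cons false) s0 ++ map (cons true) s1).
  case=> [|[] a] /= pa; first by exists [::].
  + have [a' sa' E] := R1 _ pa; exists (true :: a') => //.
    by rewrite inE mem_cat (map_f _ sa') !orbT.
  + have [a' sa' E] := R0 _ pa; exists (false :: a') => //.
    by rewrite inE mem_cat (map_f _ sa') !orbT.
Qed.

(** * Logical derivations *)

Section Logic.
Variables (n : nat) (T : formula -> Prop).
Local Notation prov := (SPi_provable_sequent n T).

Lemma provable_weak G D : prov G -> prov (G `+` D).
Proof.
by move=> H; apply: (@provable_rule _ _ (IWeak G D)) => // -[] //= ? [<-].
Qed.

Lemma provable_and G f g : prov (f +` G) -> prov (g +` G) -> prov (And f g +` G).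
Proof.
by move=> Hf Hg; apply: (@provable_rule _ _ (IAnd G f g)) => // -[] /= ? [<-].
Qed.

Lemma provable_or G f g : prov (f +` (g +` G)) -> prov (Or f g +` G).
Proof.
by move=> H; apply: (@provable_rule _ _ (IOr G f g)) => // -[] //= ? [<-].
Qed.

Lemma provable_all G y f z :
  z \notin fv_sequent (All y f +` G) -> substitutable y (Var z) f ->
  prov (subst y (Var z) f +` G) -> prov (All y f +` G).
Proof.
by move=> ? ? H; apply: (@provable_rule _ _ (IAll G y f z)) => // -[] //= ? [<-].
Qed.

Lemma provable_ex G y f t :
  substitutable y t f ->
  prov (subst y t f +` (Ex y f +` G)) -> prov (Ex y f +` G).
Proof.
by move=> ? H; apply: (@provable_rule _ _ (IEx G y f t)) => // -[] //= ? [<-].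
Qed.

Lemma provable_cut G f : prov (f +` G) -> prov (neg f +` G) -> prov G.
Proof.
by move=> Hf Hg; apply: (@provable_rule _ _ (ICut G f)) => // -[] /= ? [<-].
Qed.

(** Initial sequents give this for equations only; the rest is an induction on the size of [f],
    decomposing [f] and [neg f] in parallel. *)
Lemma provable_id f G : prov (f +` (neg f +` G)).
Proof.
(* Since [neg] is involutive, this reduces [Or] and [Ex] to the dual cases [And] and [All]. *)
have sym g : (forall D, prov (neg g +` (g +` D))) ->
    forall D, prov (g +` (neg g +` D)).
  by move=> H D; rewrite msetDCA.
have id_and g h : (forall D, prov (g +` (neg g +` D))) ->
    (forall D, prov (h +` (neg h +` D))) ->
    forall D, prov (And g h +` (neg (And g h) +` D)).
  move=> Hg Hh D; rewrite msetDCA; apply: provable_or.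
  rewrite [neg h +` _]msetDCA [neg g +` _]msetDCA.
  by apply: provable_and; last rewrite [neg g +` _]msetDCA.
have id_all y g :
    (forall z D, prov (subst y (Var z) g +` (neg (subst y (Var z) g) +` D))) ->
    forall D, prov (All y g +` (neg (All y g) +` D)).
  move=> Hg D /=.
  (* The conjunction makes [z] substitutable in [g], for the universal rule, and in [neg g], for the
     existential one. *)
  have [z zfresh /= /andP[zg zn]] := fresh_var y (And g (neg g))
    (fv_sequent (All y g +` (Ex y (neg g) +` D))).
  apply: provable_all zfresh zg _; rewrite msetDCA.
  apply: provable_ex zn _.
  by rewrite subst_neg [Ex _ _ +` _]msetDCA msetDCA.
elim: {f}(formula_size f).+1 {-2}f (ltnSn (formula_size f)) G => // k IH.
have IHn g : formula_size g < k -> forall D, prov (neg g +` (neg (neg g) +` D)).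
  by move=> ?; apply: IH; rewrite formula_size_neg.
case=> [t u | t u | f g | f g | y f | y f] /=; rewrite ?ltnS => le_k.
- by move=> G; apply: (@provable_rule _ _ (IId G t u)) => // -[].
- by move=> G; rewrite msetDCA; apply: (@provable_rule _ _ (IId G t u)) => // -[].
- by apply: id_and; apply: IH; apply: leq_trans le_k;
    rewrite ltnS ?leq_addr ?leq_addl.
- apply: (sym (Or f g)) => D.
  have := id_and (neg f) (neg g) _ _ D; rewrite /= !negK; apply=> E.
    rewrite -{2}(negK f); apply: IHn.
    by apply: leq_trans le_k; rewrite ltnS leq_addr.
  rewrite -{2}(negK g); apply: IHn.
  by apply: leq_trans le_k; rewrite ltnS leq_addl.
- by apply: id_all => z; apply: IH; rewrite formula_size_subst.
- apply: (sym (Ex y f)) => D; have := id_all y (neg f) _ D; rewrite /= negK; apply.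
  by move=> z E; apply: IH; rewrite formula_size_subst formula_size_neg.
Qed.

(** Inverts the quantifier and the implication by a cut: the negated cut formula is
    [Ex x (And f (neg g))], and its instance at [x] itself splits into two identity sequents. *)
Lemma provable_instance x f g :
  prov [mset All x (Imp f g)] -> prov (neg f +` [mset g]).
Proof.
move=> H; apply: (@provable_cut _ (All x (Imp f g))); first exact: provable_weak.
rewrite /= negK; apply: (@provable_ex _ _ _ (Var x)); first exact: substitutable_id.
rewrite subst_id; apply: provable_and.
  by rewrite [Ex _ _ +` _]msetDCA; apply: provable_id.
by rewrite [neg f +` _]msetDC [Ex _ _ +` _]msetDCA msetDCA; apply: provable_id.
Qed.

End Logic.

(** * The cyclic derivation *)

Section Cycle.
Variables (n : nat) (T : formula -> Prop) (x : var) (phi : formula).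
Variables (q0 q1 : ptree).

Local Notation phiS := (subst x (Succ (Var x)) phi).
Local Notation case_inf := (ICase [mset phi] x).
Local Notation cut_inf := (ICut [mset phiS] phi).
Local Notation weak_inf := (IWeak [mset phi] [mset phiS]).

(** The cycle is unfolded by recursion: [[:: true; false; false]] leads back to the root. The exits
    are [q0] at the left premiss of case and [q1] at the right premiss of cut. *)
Fixpoint cyclic_tree (a : seq bool) : option inference :=
  match a with
  | [::] => Some case_inf
  | false :: a => q0 a
  | [:: true] => Some cut_inf
  | true :: true :: a => q1 a
  | [:: true; false] => Some weak_inf
  | true :: false :: false :: a => cyclic_tree a
  | true :: false :: true :: _ => None
  end.

Lemma cyclic_tree_ind (P : seq bool -> Prop) :
  P [::] -> P [:: true] -> P [:: true; false] ->
  (forall a, P (false :: a)) -> (forall a, P [:: true, true & a]) ->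
  (forall a, P [:: true, false, true & a]) ->
  (forall a, P a -> P [:: true, false, false & a]) -> forall a, P a.
Proof.
move=> H0 H1 H2 H3 H4 H5 H6 a.
elim: {a}(size a).+1 {-2}a (ltnSn (size a)) => // k IH.
case=> [|[] [|[] [|[] a]]] //= le_k; apply: H6; apply: IH.
by move: le_k; rewrite ltnS => /ltnW/ltnW.
Qed.

Hypothesis phiPi : Pi n.+1 phi.
Hypothesis phi_x : x \in fv phi.
Hypothesis q0_proof : proof_tree n T q0.
Hypothesis q0_root : marking q0 [::] = Some [mset subst x Zero phi].
Hypothesis q1_proof : proof_tree n T q1.
Hypothesis q1_root : marking q1 [::] = Some (neg phi +` [mset phiS]).

Lemma cyclic_tree_correct : locally_correct T cyclic_tree.
Proof.
have [[L0 _ _] [L1 _ _]] := (q0_proof, q1_proof).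
elim/cyclic_tree_ind => //=.
- split; first by rewrite fv_sequent1.
  by case; rewrite /= subst_sequent1 // -q0_root.
- by split=> // -[] //=; rewrite -q1_root.
- by split=> // -[].
Qed.

(** The three nodes of the first turn represent those of all turns; [q0] and [q1] contribute their
    own finitely many representatives. *)
Lemma cyclic_tree_regular : regular cyclic_tree.
Proof.
have [[_ _ [s0 R0]] [_ _ [s1 R1]]] := (q0_proof, q1_proof).
exists ([:: [::]; [:: true]; [:: true; false]] ++ map (cons false) s0
        ++ map (fun a => [:: true, true & a]) s1).
elim/cyclic_tree_ind => //=.
- by exists [::].
- by exists [:: true].
- by exists [:: true; false].
- move=> a /R0[a' sa' E]; exists (false :: a') => //.
  by rewrite !inE mem_cat (map_f _ sa') !orbT.
- move=> a /R1[a' sa' E]; exists [:: true, true & a'] => //.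
  by rewrite !inE mem_cat (map_f (fun a => [:: true, true & a]) sa') !orbT.
Qed.

(** Staying on the cycle means choosing [true] exactly at multiples of 3. A branch that deviates
    enters [q0] or [q1] after finitely many turns and inherits its tail from there. *)
Lemma cyclic_tree_leaving k b :
  infinite_branch cyclic_tree b -> b k <> (k %% 3 == 0) ->
  accepted n cyclic_tree b.
Proof.
have [[_ B0 _] [_ B1 _]] := (q0_proof, q1_proof).
elim: {k}k.+1 {-2}k (ltnSn k) b => // l IH k lk b pb bk.
case E0: (b 0); last first.
  have sub c : cyclic_tree (mkseq b 1 ++ c) = q0 c by rewrite /= E0.
  by apply: (accepted_shift sub); apply: B0; apply: infinite_branch_shift pb.
case E1: (b 1).
  have sub c : cyclic_tree (mkseq b 2 ++ c) = q1 c by rewrite /= E0 E1.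
  by apply: (accepted_shift sub); apply: B1; apply: infinite_branch_shift pb.
(* Weakening has no right premiss, so this choice would end the branch. *)
case E2: (b 2); first by have := pb 3; rewrite /= E0 E1 E2.
have sub c : cyclic_tree (mkseq b 3 ++ c) = cyclic_tree c by rewrite /= E0 E1 E2.
case: k lk bk => [|[|[|k]]] lk; rewrite ?E0 ?E1 ?E2 // => bk.
apply: (accepted_shift sub); apply: (IH k).
- by move: lk; rewrite ltnS => /ltnW/ltnW.
- exact: infinite_branch_shift pb.
- by move: bk; rewrite -[k.+3]add3n modnDl.
Qed.

(** The default of [nth] is never reached, as [k %% 3 < 3]. *)
Lemma cyclic_tree_staying b k :
  (forall i, b i = (i %% 3 == 0)) ->
  cyclic_tree (mkseq b k) =
    Some (nth case_inf [:: case_inf; cut_inf; weak_inf] (k %% 3)).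
Proof.
elim: {k}k.+1 {-2}k (ltnSn k) b => // l IH [|[|[|k]]] lk b Eb;
  try by rewrite /= ?Eb.
rewrite -[k.+3]add3n mkseq_add /= !Eb /= modnDl; apply: IH.
  by move: lk; rewrite ltnS => /ltnW/ltnW.
by move=> i; rewrite Eb modnDl.
Qed.

Lemma cyclic_tree_accepted b :
  infinite_branch cyclic_tree b -> accepted n cyclic_tree b.
Proof.
move=> pb.
have [Eb | ] := classic (forall k, b k = (k %% 3 == 0)); last first.
  by move/not_all_ex_not=> [k]; apply: cyclic_tree_leaving.
have staying k := @cyclic_tree_staying b k Eb.
have mod3 k : [\/ k %% 3 = 0, k %% 3 = 1 | k %% 3 = 2].
  by have := ltn_pmod k (isT : 0 < 3); case: (k %% 3) => [|[|[|]]] // _;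
    [constructor 1 | constructor 2 | constructor 3].
exists 0; split; split.
- by move=> k G z _; rewrite staying Eb; have [] := mod3 k => ->.
- by move=> k G z _ _ _ m D y f _; rewrite staying; have [] := mod3 m => ->.
- exists x => m; exists (3 * m), [mset phi].
  by rewrite staying Eb modnMr leq_pmull.
- by move=> k G f g _; rewrite staying; have [] := mod3 k => ->.
- by move=> k G y f z _; rewrite staying; have [] := mod3 k => ->.
- by move=> k G f _; rewrite staying Eb; have [] := mod3 k => -> //= -[_ <-].
- move=> k G z _; rewrite staying Eb; have [] := mod3 k => -> //= -[<- _] _ f.
  by rewrite in_mset1 => /eqP ->.
Qed.

Lemma cyclic_tree_proof : proof_tree n T cyclic_tree.
Proof.
split; [exact: cyclic_tree_correct | exact: cyclic_tree_accepted |].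
exact: cyclic_tree_regular.
Qed.

End Cycle.

Theorem lemma6p1 (n : nat) (T : formula -> Prop)
    (hT : forall psi, T psi -> sentence psi) (x : var) (phi : formula)
    (hphi : Pi (S n) phi)
    (h0 : SPi_provable n T (subst x Zero phi))
    (hs : SPi_provable n T (All x (Imp phi (subst x (Succ (Var x)) phi)))) :
  SPi_provable n T (All x phi).
Proof.
suff: SPi_provable_sequent n T [mset phi].
  move=> H; rewrite /SPi_provable -[[mset All x phi]]msetD0.
  (* The bound variable [x] may itself be active, not being free in [All x phi]. *)
  apply: (@provable_all _ _ _ _ _ x); rewrite ?subst_id ?msetD0 //.
    by rewrite fv_sequent1 /= mem_filter eqxx.
  exact: substitutable_id.
(* The case rule requires [x] to be free in [phi]; otherwise [phi] coincides with the given
   [phi(0)]. *)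
case: (boolP (x \in fv phi)) => [phi_x | /subst_notin E]; last first.
  by rewrite -(E Zero).
have [q0 P0 M0] := (SPi_provable_sequentP _ _ _).1 h0.
have [q1 P1 M1] := (SPi_provable_sequentP _ _ _).1 (provable_instance hs).
apply/SPi_provable_sequentP; exists (cyclic_tree x phi q0 q1) => //.
exact: cyclic_tree_proof.
Qed.
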